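(* Given a connected graph $G(V,E)$ with lightest tone $lt_G=\frac{1}{k}$, where $k$ is a natural number, and $f$ a maximum contrast greyscale of $G$, a $(k+1)$-colouring of $G$ is obtained from $f$.
   Context: Graphs are finite, undirected and simple. A greyscale of $G(V,E)$ is a map $f:V\to[0,1]$ such that the values $0$ and $1$ belong to $\mathrm{Im}(f)$. For each edge $e=\{u,v\}\in E$ put $\widehat f(e)=|f(u)-f(v)|$. The contrast vector $cont(G,f)$ is the vector of all values $\widehat f(e)$, $e\in E$, listed in ascending order. Contrast vectors are compared in the lexicographical order, and $cont_{max}(G)$ denotes the maximum of $cont(G,f)$ over all greyscales $f$ of $G$. A maximum contrast greyscale of $G$ is a greyscale $f$ with $cont(G,f)=cont_{max}(G)$. The lightest tone $lt_G$ is the first component of $cont_{max}(G)$. A $(k+1)$-colouring of $G$ is a colouring of the vertices of $G$ with $k+1$ colours in which adjacent vertices always have different colours. *)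

(* Defs.v *)
From HB Require Import structures.
From mathcomp Require Import all_boot all_order all_algebra.
From mathcomp Require Import classical_sets reals.

Set Implicit Arguments.
Unset Strict Implicit.
Unset Printing Implicit Defensive.

Import Order.TTheory GRing.Theory Num.Theory.
Local Open Scope ring_scope.

Section Greyscales.
Variables (R : realType) (T : finType) (e : rel T).

Definition connected_graph : Prop := forall u v : T, connect e u v.

Definition greyscale (f : T -> R) : Prop :=
  [/\ forall v, 0 <= f v <= 1, exists v, f v = 0 & exists v, f v = 1].

(* Each edge {u, v} is represented once, by the pair whose first component
   comes first in the enumeration of T; the contrast of an edge does not depend
   on this orientation. *)
Definition edges : seq (T * T) :=
  [seq p <- enum {: T * T} | e p.1 p.2 && (enum_rank p.1 < enum_rank p.2)%N].

Definition edge_contrast (f : T -> R) (p : T * T) : R := `|f p.1 - f p.2|.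

Definition cont (f : T -> R) : seq R :=
  sort <=%R [seq edge_contrast f p | p <- edges].

Definition lex_le (s t : seq R) : bool :=
  ((s : seqlexi R) <= (t : seqlexi R))%O.

Definition is_cont_max (c : seq R) : Prop :=
  (exists2 f, greyscale f & cont f = c) /\
  (forall g, greyscale g -> lex_le (cont g) c).

(* The lexicographic maximum is unique when it exists; the value is [::] if
   there is none (e.g. if T has fewer than two elements). *)
Definition cont_max : seq R := xget [::] is_cont_max.

Definition max_contrast_greyscale (f : T -> R) : Prop :=
  greyscale f /\ cont f = cont_max.

Definition lightest_tone : R := head 0 cont_max.

Definition is_colouring (n : nat) (c : T -> 'I_n) : Prop :=
  forall u v, e u v -> c u != c v.

End Greyscales.

(* Main.v *)
Require Import Defs.
From mathcomp Require Import all_boot all_order all_algebra.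
From mathcomp Require Import reals.
From mathcomp Require Import lra.

(** Adjacent vertices have tones at distance at least [1/k], the least entry of
    the contrast vector. The intervals [[i/k, (i+1)/k[] with [i < k], together
    with the point [1], are [k+1] sets covering [[0, 1]], none of which contains
    two points at distance [1/k] or more; so they are the colour classes. *)

Import Order.TTheory GRing.Theory Num.Theory.
Local Open Scope ring_scope.

Lemma lightest_tone_le (R : realType) (T : finType) (e : rel T) (f : T -> R)
    (u v : T) :
  symmetric e -> irreflexive e -> max_contrast_greyscale e f -> e u v ->
  lightest_tone R e <= `|f u - f v|.
Proof.
move=> esym eirr [_ fmax] euv.
(* [edges] holds only the orientation of increasing rank; the contrast is symmetric, so the other
   one reduces to it. *)
wlog ltuv : u v euv / (enum_rank u < enum_rank v)%N => [wlog_uv|].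
  have [ltuv|ltvu|/val_inj/enum_rank_inj uv] :=
    ltngtP (enum_rank u) (enum_rank v).
  - exact: wlog_uv.
  - by rewrite distrC; apply: wlog_uv; rewrite // esym.
  - by rewrite uv eirr in euv.
have : `|f u - f v| \in cont e f.
  rewrite mem_sort; apply/mapP; exists (u, v) => //.
  by rewrite mem_filter /= euv ltuv mem_enum.
have : sorted <=%R (cont e f) by exact: sort_le_sorted.
rewrite /lightest_tone -fmax; case: (cont e f) => //= a s.
by move=> /(order_path_min le_trans)/allP amin /[1!inE] /predU1P[->|/amin].
Qed.

Lemma truncn_eq_dist_lt1 (R : realType) (x y : R) :
  0 <= x -> 0 <= y -> Num.truncn x = Num.truncn y -> `|x - y| < 1.
Proof.
move=> /truncn_itv/andP[lex ltx] /truncn_itv/andP[ley lty] exy.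
move: lex ltx ley lty; rewrite exy -!natr1 ltr_norml => *.
by apply/andP; split; lra.
Qed.

(** Choosing [phi] before the graph and [f] expresses that the colouring is obtained from [f]: a
    colour depends on the tone alone. *)
Theorem theorem3p4 (R : realType) (k : nat) (hk : (0 < k)%N) :
  exists phi : R -> 'I_k.+1,
    forall (T : finType) (e : rel T),
      symmetric e -> irreflexive e -> connected_graph e ->
      lightest_tone R e = 1 / k%:R ->
      forall f : T -> R, max_contrast_greyscale e f ->
        is_colouring e (phi \o f).
Proof.
(* The colour is the index of the interval; tone [1] alone gets index [k]. By [fk], [inord] never
   falls back to its default on a tone. *)
exists (fun x => inord (Num.truncn (x * k%:R))).
move=> T e esym eirr _ tone f fmax u v euv.
have k0 : 0 < k%:R :> R by rewrite ltr0n.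
have [[f01 _ _] _] := fmax.
have f0 w : 0 <= f w * k%:R by have /andP[? _] := f01 w; rewrite mulr_ge0 ?ler0n.
have fk w : (Num.truncn (f w * k%:R) < k.+1)%N.
  have /andP[_ fw1] := f01 w; have /andP[trunc_le _] := truncn_itv (f0 w).
  by rewrite ltnS -(ler_nat R) (le_trans trunc_le)// ler_piMl ?ler0n.
(* Equal colours would put the tones scaled by [k] less than [1] apart, hence the contrast of [u]
   and [v] below [1 / k]. *)
apply/eqP => /(congr1 val); rewrite /= !inordK// => /truncn_eq_dist_lt1.
move=> /(_ (f0 u) (f0 v)); apply/negP; rewrite -leNgt.
rewrite -mulrBl normrM (gtr0_norm k0) -ler_pdivrMr// -tone.
exact: lightest_tone_le.
Qed.
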